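(* Let $P$ be the set of centers of tiles of one of the regular tilings $\mathcal{T}\in\{(4^4),(6^3),(3^6)\}$ (positioned as in the context), and let $\varphi_\alpha(z)=\exp(2\pi i z/\alpha)$ with $\alpha$ admissible for $\mathcal{T}$. Let $\Gamma$ be a sublattice of $\mathbb{Z}[\xi]$. Then the coloring $\mathcal{C}_P$ of $P$ induced by $\Gamma$ is compatible with $\varphi_\alpha$ if and only if $\alpha\in\Gamma$.
   Context: The plane is identified with $\mathbb{C}$, $\mathbb{C}^*=\mathbb{C}\setminus\{0\}$, $i=\sqrt{-1}$, $\omega=e^{2\pi i/3}$. The regular tilings are positioned as follows; $P$ is the set of centers of the tiles and $\Lambda$ the orbit of $0$ under the group of translations preserving $\mathcal{T}$. $(4^4)$: unit squares with $P=\mathbb{Z}[i]$; $\Lambda=\mathbb{Z}[i]$. $(6^3)$: regular hexagons with $P=\mathbb{Z}[\omega]$; $\Lambda=\mathbb{Z}[\omega]$. $(3^6)$: equilateral triangles whose set of vertices is the ideal $P_0=(2+\omega)$ of $\mathbb{Z}[\omega]$ (side length $\sqrt3$); $P=\mathbb{Z}[\omega]\setminus P_0$ and $\Lambda=P_0$. Put $\xi=i$ for $(4^4)$ and $\xi=\omega$ for $(6^3)$ and $(3^6)$. A number $\alpha\in\mathbb{C}^*$ is admissible for $\mathcal{T}$ if $\alpha\in\Lambda$ and $|\alpha|>\max\{|z_1-z_2| : z_1,z_2\in\partial T,\ T\in\mathcal{T}\}$. A sublattice of $\mathbb{Z}[\xi]$ is a subgroup of finite index. A coloring of a set is a partition of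 it into finitely many nonempty classes (colors). The coloring of $\mathbb{Z}[\xi]$ induced by a sublattice $\Gamma$ is the partition $\{X_i\}_{i=1}^m$ into the cosets of $\Gamma$. The coloring $\mathcal{C}_P$ of $P$ induced by $\Gamma$ is $\{X_i\cap P : X_i\cap P\neq\varnothing\}$ (which is just $\{X_i\}$ for $(4^4)$ and $(6^3)$). Let $Q_\alpha=\{\varphi_\alpha(t) : t\in P\}$. A coloring $\mathcal{C}_P=\{Y_j\}$ of $P$ is compatible with $\varphi_\alpha$ if $\{\varphi_\alpha(Y_j)\}$ is a coloring of $Q_\alpha$ in the sense that each point of $Q_\alpha$ receives exactly one color, i.e. $\varphi_\alpha(Y_j)\cap\varphi_\alpha(Y_k)=\varnothing$ whenever $j\neq k$. *)

(* Defs.v *)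
(* The complex plane is R[i] over an arbitrary R : realType. *)
From mathcomp Require Import all_boot all_order all_algebra.
From mathcomp Require Import all_classical all_reals all_analysis.
From mathcomp.real_closed Require Import complex.

Set Implicit Arguments.
Unset Strict Implicit.
Unset Printing Implicit Defensive.

Import Order.TTheory GRing.Theory Num.Theory.
Import numFieldNormedType.Exports.

Local Open Scope classical_set_scope.
Local Open Scope ring_scope.
Local Open Scope complex_scope.

Definition cexp (R : realType) (z : R[i]) : R[i] :=
  (expR (complex.Re z))%:C * (cos (complex.Im z) +i* sin (complex.Im z)).

Definition omega (R : realType) : R[i] := cexp (2 * (pi : R)%:C * 'i%C / 3).

(* Z[xi] for xi a root of a monic integer quadratic polynomial. *)
Definition Zadjoin (R : realType) (xi : R[i]) : set R[i] :=
  [set z | exists a b : int, z = a%:~R + b%:~R * xi].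

Inductive regular_tiling := T44 | T63 | T36.

Definition xi (R : realType) (tau : regular_tiling) : R[i] :=
  match tau with T44 => 'i%C | T63 | T36 => omega R end.

Definition P0 (R : realType) : set R[i] :=
  [set (2 + omega R) * z | z in Zadjoin (omega R)].
Arguments P0 R z : clear implicits.

Definition centers (R : realType) (tau : regular_tiling) : set R[i] :=
  match tau with
  | T44 => Zadjoin 'i%C
  | T63 => Zadjoin (omega R)
  | T36 => Zadjoin (omega R) `\` P0 R
  end.
Arguments centers R tau z : clear implicits.

(* Vertices of the tile centered at c.  A unit square has circumradius
   |(1 + i) / 2|; the hexagonal cells of Z[omega] have circumradius
   |(2 + omega) / 3| = 1 / sqrt 3, and - omega is a primitive sixth root of
   unity; a triangle of side sqrt 3 has circumradius 1. *)
Definition vertices (R : realType) (tau : regular_tiling) (c : R[i]) :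
    set R[i] :=
  match tau with
  | T44 => [set c + (1 + 'i%C) / 2 * 'i%C ^+ k | k in [set: nat]]
  | T63 => [set c + (2 + omega R) / 3 * (- omega R) ^+ k | k in [set: nat]]
  | T36 => [set z | P0 R z /\ `|z - c| = 1]
  end.

(* Rcomplex R is R[i] with its structure of real vector space. *)
Definition convex_hull (R : realType) (A : set R[i]) : set R[i] :=
  smallest (fun B : set R[i] => @convex_set R (Rcomplex R) B) A.

Definition tile (R : realType) (tau : regular_tiling) (c : R[i]) : set R[i] :=
  convex_hull (vertices tau c).

Definition tiling (R : realType) (tau : regular_tiling) : set (set R[i]) :=
  [set tile tau c | c in centers R tau].
Arguments tiling R tau T : clear implicits.

Definition boundary (T : topologicalType) (A : set T) : set T :=
  closure A `\` interior A.

(* The translation by v maps 0 to v, so the orbit of 0 under the translations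
   preserving the tiling is the set of the vectors of these translations. *)
Definition Lambda (R : realType) (tau : regular_tiling) : set R[i] :=
  [set v | [set [set z + v | z in T] | T in tiling R tau] = tiling R tau].
Arguments Lambda R tau v : clear implicits.

(* R[i]^o carries the topology given by the modulus. *)
Definition boundary_distances (R : realType) (tau : regular_tiling) :
    set R[i] :=
  [set d | exists (T : set R[i]) (z1 z2 : R[i]), [/\ tiling R tau T,
     boundary (T : set R[i]^o) z1, boundary (T : set R[i]^o) z2 &
     d = `|z1 - z2|]].
Arguments boundary_distances R tau d : clear implicits.

Definition is_max (R : realType) (D : set R[i]) (m : R[i]) : Prop :=
  D m /\ ubound D m.

Definition admissible (R : realType) (tau : regular_tiling) (alpha : R[i]) :
    Prop :=
  [/\ alpha != 0, Lambda R tau alpha &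
      exists2 m, is_max (boundary_distances R tau) m & m < `|alpha|].

Definition phi (R : realType) (alpha z : R[i]) : R[i] :=
  cexp (2 * (pi : R)%:C * 'i%C * z / alpha).

Definition cosets (R : realType) (L Gamma : set R[i]) : set (set R[i]) :=
  [set [set z + g | g in Gamma] | z in L].

Definition sublattice (R : realType) (L Gamma : set R[i]) : Prop :=
  [/\ Gamma `<=` L, zmod_closed [in Gamma] & finite_set (cosets L Gamma)].

(* A coloring given as a family F of color classes indexed by D; distinct
   indices must have disjoint classes. *)
Definition coloring (T I : Type) (D : set I) (F : I -> set T) (A : set T) :
    Prop :=
  finite_set D /\ partition D F A.

Definition induced_coloring (R : realType) (L Gamma P : set R[i]) :
    set (set R[i]) :=
  [set Y | Y !=set0 /\ exists2 X, cosets L Gamma X & Y = X `&` P].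

Definition compatible (R : realType) (P : set R[i]) (CP : set (set R[i]))
    (f : R[i] -> R[i]) : Prop :=
  coloring CP (fun Y => f @` Y) (f @` P).

(* Main.v *)
(* phi_alpha z = phi_alpha w iff z - w is an integer multiple of alpha, so if
   alpha lies in Gamma then only points of one coset of Gamma are identified.
   Conversely, a translation of the tiling by alpha moves each tile center to
   a tile center: each tile lies in its circumscribed disk and has vertices on
   the circle with barycenter at the center, which determines the center.  So z
   and z + alpha are both centers for some z; as phi_alpha identifies them,
   they have the same color, that is alpha lies in Gamma. *)
Require Import Defs.
From mathcomp Require Import all_boot all_order all_algebra.
From mathcomp Require Import all_classical all_reals all_analysis.
From mathcomp.real_closed Require Import complex.
From mathcomp Require Import ring lra zify.

Set Implicit Arguments.
Unset Strict Implicit.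
Unset Printing Implicit Defensive.

Import Order.TTheory GRing.Theory Num.Theory.

Local Open Scope classical_set_scope.
Local Open Scope ring_scope.
Local Open Scope complex_scope.

(** * The complex exponential and its periods *)

Lemma periodicz (U V : zmodType) (f : U -> V) (T : U) (n : int) (a : U) :
  periodic f T -> f (a + T *~ n) = f a.
Proof.
move=> fT; case: n => n; first by rewrite -pmulrn (periodicn fT).
by rewrite NegzE mulrNz -pmulrn -[in RHS](subrK (T *+ n.+1) a) (periodicn fT).
Qed.

Lemma cos_eq1 (R : realType) (x : R) :
  cos x = 1 -> exists n : int, x = (pi *+ 2) *~ n.
Proof.
move=> cosx; have pi0 := pi_gt0 R.
have pi2 : 0 < pi *+ 2 :> R by rewrite pmulrn_rgt0.
(* This [n] puts [x - 2 * pi * n] into [-pi, pi), so its absolute value lies in [0, pi], where [cos]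
   is injective and takes the value 1 at 0. *)
exists (Num.floor ((x + pi) / (pi *+ 2))).
have := floor_itv ((x + pi) / (pi *+ 2)); set n := Num.floor _.
rewrite ler_pdivlMr// ltr_pdivrMr// intrD mulrDl mul1r => /andP[n1 n2].
have xE : x = x - (pi *+ 2) *~ n + (pi *+ 2) *~ n by rewrite subrK.
have nE : (pi *+ 2) *~ n = n%:~R * (pi *+ 2) :> R by rewrite mulrzl.
have : `|x - n%:~R * (pi *+ 2)| = 0.
  apply: cos_inj.
  - by rewrite in_itv/= normr_ge0 ler_norml; lra.
  - by rewrite in_itv/= lexx ltW.
  - rewrite cos_norm cos0 -[RHS]cosx -nE [in RHS]xE periodicz//; exact: cosD2pi.
by move/eqP; rewrite normr_eq0 subr_eq0 -nE => /eqP.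
Qed.

Section cexp.
Context {R : realType}.
Implicit Types z w : R[i].

Lemma cexpD z w : cexp (z + w) = cexp z * cexp w.
Proof.
case: z w => [a b] [c d]; rewrite /cexp/= expRD cosD sinD.
by apply/eqP; rewrite eq_complex/=; apply/andP; split; apply/eqP; ring.
Qed.

Lemma cexp0 : cexp (0 : R[i]) = 1.
Proof. by rewrite /cexp/= expR0 cos0 sin0 mul1r. Qed.

Lemma cexp_neq0 z : cexp z != 0.
Proof.
apply/negP => /eqP z0; have := cexpD z (- z).
by rewrite subrr cexp0 z0 mul0r => /eqP; rewrite oner_eq0.
Qed.

Lemma cexpB z w : cexp (z - w) = cexp z / cexp w.
Proof.
by apply: (mulIf (cexp_neq0 w)); rewrite -cexpD subrK divfK// cexp_neq0.
Qed.

Lemma cexp_eq1 z :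
  cexp z = 1 <-> exists n : int, z = 2 * (pi : R)%:C * 'i%C * n%:~R.
Proof.
have E n : 2 * (pi : R)%:C * 'i%C * n%:~R = 0 +i* ((pi *+ 2) *~ n) :> R[i].
  rewrite -(rmorph_nat (real_complex R)) -(rmorph_int (real_complex R)).
  rewrite -mulrzl -mulr_natl.
  by apply/eqP; rewrite eq_complex/=; apply/andP; split; apply/eqP; ring.
split=> [|[n ->]]; last first.
  rewrite E /cexp/= expR0 mul1r -[_ *~ n]add0r.
  rewrite (periodicz _ _ (@cosD2pi R)) (periodicz _ _ (@sinD2pi R)).
  by rewrite cos0 sin0.
case: z => a b /eqP; rewrite /cexp eq_complex/= !mul0r subr0 addr0.
move=> /andP[/eqP cb]; rewrite mulf_eq0 expR_eq0/= => /eqP sb.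
have := cos2Dsin2 b; rewrite sb expr0n addr0 => /eqP; rewrite sqrf_eq1.
(* Since [expR a * cos b = 1] with [expR a] positive, [cos b = -1] is impossible; then [cos b = 1]
   forces [expR a = 1], that is [a = 0]. *)
case/orP => /eqP cosb; last first.
  by have := expR_gt0 a; rewrite cosb mulrN1 in cb; lra.
have [n ->] := cos_eq1 cosb; exists n; rewrite E.
by move: cb; rewrite cosb mulr1 -expR0 => /expR_inj ->.
Qed.
End cexp.

Lemma phi_eq (R : realType) (alpha z w : R[i]) : alpha != 0 ->
  phi alpha z = phi alpha w <-> exists n : int, z - w = alpha *~ n.
Proof.
move=> a0; have c0 : 2 * (pi : R)%:C * 'i%C != 0 :> R[i].
  have pi0 : (pi : R)%:C != 0 by rewrite fmorph_eq0 gt_eqF// pi_gt0.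
  by rewrite !mulf_neq0// ?pnatr_eq0// -normr_eq0 normCi oner_eq0.
have -> : (phi alpha z = phi alpha w) <->
    cexp (2 * (pi : R)%:C * 'i%C * ((z - w) / alpha)) = 1.
  rewrite mulrBl mulrBr cexpB !mulrA /phi; split=> [->|/divr1_eq//].
  by rewrite divff// cexp_neq0.
rewrite cexp_eq1; split=> -[n E]; exists n.
  by move/(mulfI c0): E => /(canRL (divfK a0)) ->; rewrite mulrzl.
by congr (_ * _); rewrite E -[alpha *~ n]mulrzr mulrAC mulfV// mul1r.
Qed.

(** In the sum over [s] of |w + v|^2 - |v|^2, the cross terms are linear in [v] or in its conjugate
    and cancel, which leaves [size s] times |w|^2. Each summand is at most 0, so [w] vanishes. It
    will be applied to the difference [w] of two candidate centers of one tile. *)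
Lemma norm_add_centered_le (C : numClosedFieldType) (s : seq C) (r w : C) :
  s != [::] -> \sum_(v <- s) v = 0 ->
  {in s, forall v, `|v| = r} -> {in s, forall v, `|w + v| <= r} -> w = 0.
Proof.
move=> s0 sum0 normv lev.
have conj0 : \sum_(v <- s) v^* = 0 by rewrite -rmorph_sum sum0 rmorph0.
have : \sum_(v <- s) (`|w + v| ^+ 2 - `|v| ^+ 2) <= 0.
  rewrite big_seq; apply: sumr_le0 => v vs.
  by rewrite subr_le0 lerXn2r ?nnegrE// (normv v vs) lev.
have -> : \sum_(v <- s) (`|w + v| ^+ 2 - `|v| ^+ 2) =
    \sum_(v <- s) (`|w| ^+ 2 + (w * v^* + v * w^*)).
  by apply: eq_bigr => v _; rewrite !normCK rmorphD/=; ring.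
rewrite !big_split/= -[X in _ + (X + _)]mulr_sumr -[X in _ + (_ + X)]mulr_suml.
rewrite sum0 conj0 mulr0 mul0r !addr0 big_const_seq iter_addr_0 count_predT.
rewrite pmulrn_lle0 ?lt0n ?size_eq0// real_exprn_even_le0// ?normr_real//.
by rewrite normr_eq0 => /eqP.
Qed.

(** * Arithmetic of Z[omega] and of the ideal generated by 2 + omega *)

Section omega.
Context {R : realType}.
Local Notation w := (omega R).

Lemma omega_def : w = cos (2 * pi / 3) +i* sin (2 * pi / 3).
Proof.
have -> : omega R = cexp (0 +i* (2 * pi / 3)).
  rewrite /omega -(rmorph_nat (real_complex R)).
  rewrite -[3 in LHS](rmorph_nat (real_complex R)).
  rewrite -fmorphV; congr cexp.
  by apply/eqP; rewrite eq_complex/=; apply/andP; split; apply/eqP; ring.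
by rewrite /cexp/= expR0 mul1r.
Qed.

Lemma Im_omega_gt0 : 0 < complex.Im w.
Proof.
by rewrite omega_def; apply: sin_gt0_pi; have := pi_gt0 R; lra.
Qed.

Lemma omega_pow3 : w ^+ 3 = 1.
Proof.
rewrite /omega !exprS expr0 mulr1 -!cexpD; apply/cexp_eq1; exists 1.
by field.
Qed.

Lemma sqr_omega : w ^+ 2 = - 1 - w.
Proof.
have w1 : w - 1 != 0.
  apply/negP; rewrite subr_eq0 => /eqP w1; have := Im_omega_gt0.
  by rewrite w1 ltxx.
apply: (mulfI w1); have -> : (w - 1) * w ^+ 2 = w ^+ 3 - w ^+ 2 by ring.
by rewrite omega_pow3; ring.
Qed.

Lemma norm_omega : `|w| = 1.
Proof.
by apply/eqP; rewrite -(@pexpr_eq1 _ _ 3)// -normrX omega_pow3 normr1.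
Qed.

(** The ideal has norm 3 and omega is congruent to 1 modulo it, so membership is read off [a + b]
    modulo 3. The quotient by 2 + omega is x + (b - x) omega. *)
Lemma P0_intro (a b x : int) : a + b = 3 * x -> P0 R (a%:~R + b%:~R * w).
Proof.
move=> /(canRL (addrK b)) ->; exists (x%:~R + (b - x)%:~R * w).
  by exists x, (b - x).
rewrite !(rmorphB, rmorphM)/=; have := sqr_omega; move: w => z z2.
have -> : (2 + z) * (x%:~R + (b%:~R - x%:~R) * z) =
    2 * x%:~R + z * x%:~R + 2 * (b%:~R - x%:~R) * z +
    (b%:~R - x%:~R) * z ^+ 2 by ring.
by rewrite z2; ring.
Qed.

Lemma not_P0_1 : ~ P0 R 1.
Proof.
case=> _ [a [b ->]].
have -> : (2 + w) * (a%:~R + b%:~R * w) = (2 * a - b)%:~R + (a + b)%:~R * w.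
  have -> : (2 + w) * (a%:~R + b%:~R * w) =
      2 * a%:~R + (a%:~R + 2 * b%:~R) * w + b%:~R * w ^+ 2 by ring.
  by rewrite sqr_omega rmorphB rmorphM rmorphD/=; ring.
rewrite -!(rmorph_int (real_complex R)).
have := Im_omega_gt0; case: w => x y /= y0.
(* The imaginary part gives [a + b = 0] and the real part then [2 * a - b = 1], hence 3 a = 1, which
   no integer satisfies. *)
move/eqP; rewrite eq_complex/= !mul0r subr0 addr0 add0r.
rewrite mulf_eq0 intr_eq0 (gt_eqF y0).
rewrite orbF => /andP[/eqP + /eqP ab0]; rewrite ab0 mul0r addr0 -[RHS]/(1%:~R).
by move=> /intr_inj; lia.
Qed.

End omega.

(** * Tiles, their circumscribed disks, and translations of the tiling *)

Definition circumradius (R : realType) (tau : regular_tiling) : R[i] :=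
  match tau with
  | T44 => `|(1 + 'i%C) / 2|
  | T63 => `|(2 + omega R) / 3|
  | T36 => 1
  end.
Arguments circumradius R tau : clear implicits.

Section tiles.
Context {R : realType}.
Implicit Types (tau : regular_tiling) (c z alpha : R[i]).

Lemma convex_closed_disk c (r : R[i]) :
  @convex_set R (Rcomplex R) [set z : R[i] | `|z - c| <= r].
Proof.
move=> x y t /[!inE]/= xr yr.
have t0 : 0 <= (t%:num)%:C :> R[i] by rewrite lecR.
have t1 : 0 <= 1 - (t%:num)%:C :> R[i] by rewrite subr_ge0 lecR.
have -> : (conv t x y : R[i]) - c =
    (t%:num)%:C * ((x : R[i]) - c) + (1 - (t%:num)%:C) * ((y : R[i]) - c).
  have -> : conv t x y = (t%:num)%:C * x + (1 - t%:num)%:C * y :> R[i].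
    case: x {xr} => x1 x2; case: y {yr} => y1 y2.
    apply/eqP; rewrite eq_complex/= /unstable.onem.
    by apply/andP; split; apply/eqP; ring.
  by rewrite rmorphB; ring.
rewrite (le_trans (ler_normD _ _))// !normrM (ger0_norm t0) (ger0_norm t1).
have -> : r = (t%:num)%:C * r + (1 - (t%:num)%:C) * r by ring.
by rewrite lerD// ler_wpM2l.
Qed.

Lemma norm_vertices tau c z :
  vertices tau c z -> `|z - c| = circumradius R tau.
Proof.
have norm_i : `|'i%C : R[i]| = 1 by exact: normCi.
case: tau => [[k _ <-]|[k _ <-]|[_ //]]; rewrite addrAC subrr add0r normrM.
- by rewrite normrX norm_i expr1n mulr1.
- by rewrite normrX normrN norm_omega expr1n mulr1.
Qed.

Lemma tile_closed_disk tau c :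
  tile tau c `<=` [set z | `|z - c| <= circumradius R tau].
Proof.
apply: smallest_sub; first exact: convex_closed_disk.
by move=> z /norm_vertices /= ->.
Qed.

(** Two opposite corners serve for the square, every other corner for the hexagon, and three corners
    differing by rotations of order 3 for the triangle. *)
Lemma vertices_centered tau c : centers R tau c ->
  exists s : seq R[i], [/\ s != [::], \sum_(v <- s) v = 0 &
    {in s, forall v, vertices tau c (c + v)}].
Proof.
case: tau => [_|_|[[a [b ->]] nP0]].
- exists [:: (1 + 'i%C) / 2 * 'i%C ^+ 0; (1 + 'i%C) / 2 * 'i%C ^+ 2].
  split=> //.
    by rewrite !big_cons big_nil addr0 -mulrDr sqr_i expr0 subrr mulr0.
  by move=> v; rewrite !inE => /orP[/eqP ->|/eqP ->]; [exists 0|exists 2].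
- exists [seq (2 + omega R) / 3 * (- omega R) ^+ k | k <- [:: 0; 2; 4]%N].
  split=> //.
    rewrite big_map -mulr_sumr !big_cons big_nil addr0.
    have -> : (- omega R) ^+ 0 + ((- omega R) ^+ 2 + (- omega R) ^+ 4) =
        (omega R ^+ 2) ^+ 2 + omega R ^+ 2 + 1 by ring.
    rewrite sqr_omega; have -> : (- 1 - omega R) ^+ 2 + (- 1 - omega R) + 1 =
        omega R ^+ 2 + omega R + 1 by ring.
    by rewrite sqr_omega; ring.
  by move=> v /mapP[k _ ->]; exists k.
(* As [c] is outside [P0], 3 does not divide [a + b]. The sign [e] tells the two orientations of
   triangles apart: the corners are c + e omega^k. *)
- have [e [e1 [x abe]]] :
      exists e : int, `|e| = 1 /\ exists x, a + b + e = 3 * x.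
    have [x] : exists x,
        a + b = 3 * x \/ (a + b + 1 = 3 * x \/ a + b - 1 = 3 * x).
      (* Adding 1 before the floor division rounds (a + b) / 3 to the nearest integer. *)
      by exists ((a + b + 1) %/ 3)%Z; lia.
    case=> [abx|[abx|abx]]; first by case: nP0; exact: P0_intro abx.
      by exists 1; split=> //; exists x.
    by exists (-1); split=> //; exists x.
  exists [seq e%:~R * omega R ^+ k | k <- [:: 0; 1; 2]%N]; split=> //.
    rewrite big_map -mulr_sumr !big_cons big_nil addr0 sqr_omega expr0 expr1.
    by ring.
  have normv (k : nat) : `|e%:~R * omega R ^+ k| = 1.
    by rewrite normrM normrX norm_omega expr1n mulr1 -intr_norm e1.
  move=> v /mapP[k + ->]; rewrite !inE => k3; split; last first.
    by rewrite addrAC subrr add0r.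
  case/or3P: k3 => /eqP ->.
  + have -> : a%:~R + b%:~R * omega R + e%:~R * omega R ^+ 0 =
        (a + e)%:~R + b%:~R * omega R.
      by rewrite rmorphD/=; ring.
    by apply: (@P0_intro R _ _ x); lia.
  + have -> : a%:~R + b%:~R * omega R + e%:~R * omega R ^+ 1 =
        a%:~R + (b + e)%:~R * omega R.
      by rewrite rmorphD/=; ring.
    by apply: (@P0_intro R _ _ x); lia.
  + have -> : a%:~R + b%:~R * omega R + e%:~R * omega R ^+ 2 =
        (a - e)%:~R + (b - e)%:~R * omega R.
      by rewrite sqr_omega !rmorphB/=; ring.
    by apply: (@P0_intro R _ _ (x - e)); lia.
Qed.

Lemma Lambda_center tau alpha c :
  Lambda R tau alpha -> centers R tau c -> centers R tau (c + alpha).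
Proof.
move=> Lalpha Pc.
have [d Pd tile_d] : tiling R tau [set z + alpha | z in tile tau c].
  by rewrite -Lalpha; exists (tile tau c) => //; exists c.
have [s [s0 sum0 sV]] := vertices_centered Pd.
suff : d - (c + alpha) = 0 by move/eqP; rewrite subr_eq0 => /eqP <-.
(* The point [d + v] is a vertex of the tile of [d], which is the tile of [c] moved by [alpha]; so
   it lies in the disk around [c + alpha] as well as on the circle around [d]. *)
apply: (norm_add_centered_le (r := circumradius R tau) s0 sum0) => v /sV V.
  by rewrite -(norm_vertices V) addrAC subrr add0r.
have : tile tau d (d + v) by exact: sub_gen_smallest.
rewrite tile_d => -[z /tile_closed_disk/= zc zE].
suff -> : d - (c + alpha) + v = z - c by [].
by rewrite addrAC -zE; ring.
Qed.

Lemma centers_neq0 tau : centers R tau !=set0.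
Proof.
(* For [T36] the origin is a vertex, so 1 is taken instead. *)
case: tau; [exists 0|exists 0|exists 1]; rewrite /=.
- by exists 0, 0; rewrite mul0r addr0.
- by exists 0, 0; rewrite mul0r addr0.
- by split; [exists 1, 0; rewrite mul0r addr0|exact: not_P0_1].
Qed.

Lemma centers_sub tau : centers R tau `<=` Zadjoin (xi R tau).
Proof. by case: tau => // z []. Qed.

End tiles.

(** * Compatibility of the induced coloring *)

Theorem theorem12 (R : realType) (tau : regular_tiling) (alpha : R[i])
    (Gamma : set R[i]) :
  admissible tau alpha ->
  sublattice (Zadjoin (xi R tau)) Gamma ->
  (compatible (centers R tau)
     (induced_coloring (Zadjoin (xi R tau)) Gamma (centers R tau))
     (phi alpha)
   <-> Gamma alpha).
Proof.
move=> [alpha0 Lalpha _] [GL [G0 GB] finG].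
have G0' : Gamma 0 by move: G0; rewrite inE.
have GB' x y : Gamma x -> Gamma y -> Gamma (x - y).
  by move=> Gx Gy; have := GB x y; rewrite !inE; exact.
have GD x y : Gamma x -> Gamma y -> Gamma (x + y).
  by move=> Gx Gy; rewrite -[y]opprK -[- y]sub0r; exact/GB'/GB'.
have GM x (n : int) : Gamma x -> Gamma (x *~ n).
  move=> Gx; have GMn (m : nat) : Gamma (x *+ m).
    by elim: m => [|m IHm]; rewrite ?mulr0n// mulrS; exact: GD.
  by case: n => m; rewrite ?NegzE ?mulrNz -?pmulrn// -sub0r; exact: GB'.
have colorP z : centers R tau z ->
    induced_coloring (Zadjoin (xi R tau)) Gamma (centers R tau)
      ([set z + g | g in Gamma] `&` centers R tau).
  move=> Pz; split; first by exists z; split=> //; exists 0; rewrite ?addr0.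
  by exists [set z + g | g in Gamma] => //; exists z => //; exact: centers_sub.
split=> [[_ [_ triv _]]|Galpha].
  have [z Pz] := @centers_neq0 R tau.
  have Pza := Lambda_center Lalpha Pz.
  have phiE : phi alpha (z + alpha) = phi alpha z.
    by apply/phi_eq => //; exists 1; rewrite addrAC subrr add0r.
  have meet : (phi alpha @` ([set z + g | g in Gamma] `&` centers R tau) `&`
      phi alpha @` ([set z + alpha + g | g in Gamma] `&` centers R tau)) !=set0.
    exists (phi alpha z); split; [exists z|exists (z + alpha)] => //.
      by split=> //; exists 0; rewrite ?addr0.
    by split=> //; exists 0; rewrite ?addr0.
  (* Colors whose images meet are equal, so [z + alpha] lies in the coset of [z]. *)
  have E := triv _ _ (colorP _ Pz) (colorP _ Pza) meet.
  have : ([set z + g | g in Gamma] `&` centers R tau) (z + alpha).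
    by rewrite E; split=> //; exists 0; rewrite ?addr0.
  by move=> [[g Gg /addrI <-]].
split.
  apply: (@sub_finite_set _ _ [set X `&` centers R tau |
      X in cosets (Zadjoin (xi R tau)) Gamma]).
    by move=> Y [_ [X cX ->]]; exists X.
  exact: finite_image.
split.
- apply/seteqP; split=> [_ [Y [_ [X _ ->]] [z [_ Pz] <-]]|_ [z Pz <-]].
    by exists z.
  exists ([set z + g | g in Gamma] `&` centers R tau); first exact: colorP.
  by exists z => //; split=> //; exists 0; rewrite ?addr0.
- move=> _ _ [_ [_ [a _ <-] ->]] [_ [_ [b _ <-] ->]].
  move=> [_ [[_ [[g Gg <-] _] <-] [_ [[h Gh <-] _]]]].
  move=> /phi_eq-/(_ alpha0)[n bhag].
  have Gba : Gamma (b - a).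
    (* The identified points [b + h] and [a + g] differ by a multiple of [alpha], which lies in
       [Gamma]; hence [a] and [b] represent the same coset. *)
    have -> : b - a = (b + h - (a + g)) - (h - g) by ring.
    by rewrite bhag; apply/GB'/GB'/Gg/Gh; exact: GM.
  congr (_ `&` _); apply/seteqP; split=> [_ [k Gk <-]|_ [k Gk <-]].
    by exists (k - (b - a)); [exact: GB'|ring].
  by exists (k + (b - a)); [exact: GD|ring].
- by move=> Y [[z Yz] _]; exists (phi alpha z), z.
Qed.
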